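(* Let $U\subseteq\mathbb{R}^3$ be open and let $f:U\to\mathbb{R}$ be smooth with $X<0$ on $U$. Let $\omega_j$ be a smooth real $1$-form on $U$ that is a conjugate direction for $f$, i.e. at every point of $U$ $$f^i\omega_i=0,\qquad \omega^i\omega_i=f^if_i,\qquad f^{ij}\omega_i\omega_j+f^{ij}f_if_j=0 .$$ Then the tensor field $\omega_{ij}=\nabla_i\omega_j$ is symmetric in its indices if and only if $$f^{ijk}f_if_jf_k+f^{ijk}f_i\omega_j\omega_k+2f^{ij}f_j{}^kf_if_k-2f^{ij}f_j{}^k\omega_i\omega_k=0$$ and $$f^{ijk}f_if_j\omega_k+f^{ijk}\omega_i\omega_j\omega_k+4f^{ij}f_j{}^kf_i\omega_k=0$$ on $U$.
   Context: Indices run over $1,2,3$ and refer to standard coordinates on $\mathbb{R}^3$; they are raised and lowered with the Euclidean metric $\delta_{ij}$ and repeated indices are summed. $\nabla_i$ is the flat connection (partial derivative), $f_i=\nabla_if$, $f_{ij}=\nabla_i\nabla_jf$, $f_{ijk}=\nabla_i\nabla_j\nabla_kf$. The quantity $X$ is $$X=2f_i{}^jf_jf^{ik}f_k-f^if_i\,f^{jk}f_{jk}+f^if_i(f^j{}_j)^2 .$$ *)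

(* Defs.v *)
From HB Require Import structures.
From mathcomp Require Import all_boot all_order all_algebra.
From mathcomp Require Import all_classical all_reals all_analysis.

Set Implicit Arguments.
Unset Strict Implicit.
Unset Printing Implicit Defensive.

Import Order.TTheory GRing.Theory Num.Theory.
Import numFieldNormedType.Exports.

Local Open Scope classical_set_scope.
Local Open Scope ring_scope.

(* Points of R^3 are row vectors, with coordinates numbered 0, 1, 2 instead of
   1, 2, 3. The metric is the Euclidean delta_ij, so raising an index does not
   change a component: all tensor components below are written with lower
   indices, and every contraction is an explicit sum over 'I_3. *)

Section FlatCalculus.
Variable R : realType.
Implicit Types (U : set 'rV[R]_3) (f : 'rV[R]_3 -> R).
Implicit Types (w : 'I_3 -> 'rV[R]_3 -> R) (x : 'rV[R]_3).

Definition nabla (i : 'I_3) f : 'rV[R]_3 -> R :=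
  fun x => 'D_(delta_mx 0 i) f x.

Definition nabla2 (i j : 'I_3) f : 'rV[R]_3 -> R := nabla i (nabla j f).

Definition nabla3 (i j k : 'I_3) f : 'rV[R]_3 -> R :=
  nabla i (nabla j (nabla k f)).

(* Meant for open U: a function U -> R is represented by any total function
   extending it, since the conditions below only see values near points
   of U. *)
Fixpoint Ck (k : nat) U f : Prop :=
  match k with
  | 0 => forall x, U x -> {for x, continuous f}
  | k'.+1 => (forall x, U x -> {for x, continuous f}) /\
      forall i : 'I_3, (forall x, U x -> derivable f x (delta_mx 0 i)) /\
                       Ck k' U (nabla i f)
  end.

Definition smooth U f : Prop := forall k, Ck k U f.

(* A 1-form is given by its components with respect to the coordinates. *)
Definition smooth_form U w : Prop := forall j, smooth U (w j).

Definition Xquant f x : R :=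
  2 * (\sum_(i < 3) \sum_(j < 3) \sum_(k < 3)
         nabla2 i j f x * nabla j f x * nabla2 i k f x * nabla k f x)
  - (\sum_(i < 3) nabla i f x * nabla i f x) *
    (\sum_(j < 3) \sum_(k < 3) nabla2 j k f x * nabla2 j k f x)
  + (\sum_(i < 3) nabla i f x * nabla i f x) *
    (\sum_(j < 3) nabla2 j j f x) ^+ 2.

Definition conjugate_direction U f w : Prop :=
  forall x, U x ->
  [/\ \sum_(i < 3) nabla i f x * w i x = 0,
      \sum_(i < 3) w i x * w i x = \sum_(i < 3) nabla i f x * nabla i f x
    & \sum_(i < 3) \sum_(j < 3) nabla2 i j f x * w i x * w j x +
      \sum_(i < 3) \sum_(j < 3)
        nabla2 i j f x * nabla i f x * nabla j f x = 0].

End FlatCalculus.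

(* Main.v *)
Require Import Defs.
From HB Require Import structures.
From mathcomp Require Import all_boot all_order all_algebra.
From mathcomp Require Import all_classical all_reals all_analysis.
From mathcomp Require Import ring.
Import Order.TTheory GRing.Theory Num.Theory.
Import numFieldNormedType.Exports.
Local Open Scope classical_set_scope.
Local Open Scope ring_scope.

(** Fix a point of U and write p for the gradient of f, q for w, H for the
Hessian of f, T for its third derivative and W i j for nabla_i w_j.
Differentiating the three equations of a conjugate direction gives, in each
direction k,
  H_k . q + W_k . p = 0,   W_k . q = H_k . p,
  T_k(q, q) + 2 W_k . H q + T_k(p, p) + 2 H_k . H p = 0,
so W is known on the three vectors p, q and r = H q ([skew_conjugate]). Put
S(u, v) = u . W v - v . W u, whose vanishing is the symmetry of W. Then
  S(p, q) = p . H p + q . H q, which is 0 by the third equation,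
  - 2 S(p, r) is the left-hand side of the first identity to be proved,
  - 2 S(q, r) is the left-hand side of the second one.
The two identities thus say that S vanishes on each pair among p, q, r, and
everything follows once p, q, r are linearly independent ([skew_cramer]).

This is where X < 0 comes in. In the orthogonal frame p, q, p x q, the
condition p . H p + q . H q = 0 makes all terms of X cancel except one:
  |p|^4 X = - 2 det(p, q, H q)^2  when p <> 0
([X_frame]). So X = 0 wherever the determinant vanishes and p does not; where
p = 0, all terms of X are 0 too. Hence X < 0 excludes both cases.

The derivation needs H and T symmetric, that is, equality of mixed partial
derivatives ([derive_comm]); as usual, this follows by applying the mean value
theorem twice to a second difference of the function. *)

(** * Euclidean algebra in dimension 3 *)

Lemma sum3 {R : zmodType} (F : 'I_3 -> R) : \sum_(i < 3) F i = F 0 + F 1 + F (1 + 1).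
Proof.
rewrite !big_ord_recl big_ord0 addr0 addrA.
by congr (F _ + F _ + F _); apply/val_inj.
Qed.

Lemma ord3P (i : 'I_3) : [\/ i = 0, i = 1 | i = 1 + 1].
Proof.
case: i => [[|[|[|]]]] // lti; [apply: Or31|apply: Or32|apply: Or33]; exact: val_inj.
Qed.

Lemma ord3_3 : 1 + 1 + 1 = 0 :> 'I_3.
Proof. exact: val_inj. Qed.

Section VectorAlgebra.
Local Set Implicit Arguments.
Local Unset Strict Implicit.
Context {R : realFieldType}.
Implicit Types (p q r u v : 'I_3 -> R) (A H W : 'I_3 -> 'I_3 -> R).

Definition dot u v : R := \sum_(i < 3) u i * v i.
(** Indices are taken modulo 3, in the ring structure of ['I_3]. *)
Definition cross u v : 'I_3 -> R :=
  fun i => u (i + 1) * v (i + 1 + 1) - u (i + 1 + 1) * v (i + 1).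
Definition lapp A u : 'I_3 -> R := fun i => dot (A i) u.
(** The alternating bilinear form of the antisymmetric part of [A]. *)
Definition skew A u v : R := dot u (lapp A v) - dot v (lapp A u).

Lemma dotC u v : dot u v = dot v u.
Proof. by apply: eq_bigr => i _; rewrite mulrC. Qed.

(** When [p] and [q] are orthogonal with |p|^2 = |q|^2 = s, the vectors [p], [q]
and [cross p q] are orthogonal with squared norms s, s and s^2; this is
Parseval's identity in that frame, multiplied by s^2 to avoid dividing. *)
Lemma frame_expansion p q u v :
  dot p q = 0 -> dot q q = dot p p ->
  (dot p p) ^+ 2 * dot u v =
    dot p p * (dot p u * dot p v) + dot p p * (dot q u * dot q v)
    + dot (cross p q) u * dot (cross p q) v.
Proof.
move=> pq qq.
(* The product of the determinants of (p, q, u) and (p, q, v) is a Gram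
   determinant, without any condition on p and q. *)
have -> : dot (cross p q) u * dot (cross p q) v =
   dot p p * dot q q * dot u v - dot q q * (dot p u * dot p v)
   - dot p p * (dot q u * dot q v)
   + dot p q * (dot p u * dot q v + dot q u * dot p v - dot p q * dot u v).
  by rewrite /dot !sum3 /cross !(add0r, ord3_3); ring.
by rewrite pq qq; ring.
Qed.

Lemma dot_lappC H u v : (forall i j, H i j = H j i) ->
  dot u (lapp H v) = dot v (lapp H u).
Proof.
move=> Hsym; rewrite /dot /lapp /dot !sum3.
by rewrite (Hsym 1 0) (Hsym (1+1) 0) (Hsym (1+1) 1); ring.
Qed.

(** In dimension 3 the antisymmetric part of [W] is a vector a, in the sense that
skew W u v = a . (u x v). By Cramer's rule
  det(p, q, r) a = (a . (q x r)) p - (a . (p x r)) q + (a . (p x q)) r,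
where the three coefficients are the values of [skew W] assumed to be 0. *)
Lemma skew_cramer W p q r (i j : 'I_3) :
  skew W p q = 0 -> skew W p r = 0 -> skew W q r = 0 ->
  dot (cross p q) r * (W i j - W j i) = 0.
Proof.
move=> Wpq Wpr Wqr.
have key k : dot (cross p q) r * (W (k + 1) (k + 1 + 1) - W (k + 1 + 1) (k + 1))
   = skew W q r * p k - skew W p r * q k + skew W p q * r k.
  rewrite /skew /lapp /dot !sum3 /cross.
  by case: (ord3P k) => ->; rewrite !(add0r, ord3_3); ring.
have key0 k : dot (cross p q) r * (W (k + 1) (k + 1 + 1) - W (k + 1 + 1) (k + 1)) = 0.
  by rewrite key Wpq Wpr Wqr; ring.
have := (key0 0, key0 1, key0 (1+1)); rewrite !(add0r, ord3_3) => -[[k0 k1] k2].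
case: (ord3P i) => ->; case: (ord3P j) => ->; rewrite ?subrr ?mulr0 //;
  by apply/eqP; rewrite -oppr_eq0 -mulrN opprB; apply/eqP.
Qed.

(** The long factor is the quantity X, with [p] the gradient and [H] the Hessian.
Write it in the entries of [H] in the frame [p], [q], [cross p q], taken
orthonormal for simplicity: the trace reduces to H33 because H22 = - H11, all
that survives is - 2 H23^2, and H23 is the determinant on the right. The power
of [dot p p] on the left clears the denominators of the general case. *)
Lemma X_frame H p q : (forall i j, H i j = H j i) ->
  dot p q = 0 -> dot q q = dot p p ->
  dot q (lapp H q) + dot p (lapp H p) = 0 ->
  (dot p p) ^+ 4 *
    (2 * dot (lapp H p) (lapp H p) - dot p p * \sum_(i < 3) dot (H i) (H i)
     + dot p p * (\sum_(i < 3) H i i) ^+ 2) =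
  - 2 * (dot p p) ^+ 2 * (dot (cross p q) (lapp H q)) ^+ 2.
Proof.
move=> Hsym pq qq conj.
have exp u v := @frame_expansion p q u v pq qq.
set n := cross p q in exp *.
have eP := exp (lapp H p) (lapp H p).
have eQ := exp (lapp H q) (lapp H q).
have eN := exp (lapp H n) (lapp H n).
(* The sum of squares and the trace of H are both sums over the rows H i of dot
   products, of H i with itself and with the i-th basis vector. *)
have eF : (dot p p) ^+ 2 * \sum_(i < 3) dot (H i) (H i) =
    dot p p * dot (lapp H p) (lapp H p) + dot p p * dot (lapp H q) (lapp H q)
    + dot (lapp H n) (lapp H n).
  rewrite mulr_sumr (eq_bigr _ (fun i _ => exp (H i) (H i))).
  rewrite !big_split/= -!mulr_sumr /dot !sum3 /lapp /dot !sum3; ring.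
have eT : (dot p p) ^+ 2 * \sum_(i < 3) H i i =
    dot p p * dot p (lapp H p) + dot p p * dot q (lapp H q) + dot n (lapp H n).
  pose e i : 'I_3 -> R := fun k => (k == i)%:R.
  have dote i v : dot v (e i) = v i.
    rewrite /dot (bigD1 i)//= big1 ?addr0 /e ?eqxx ?mulr1// => k /negbTE ->.
    by rewrite mulr0.
  have Hii i : (dot p p) ^+ 2 * H i i = dot p p * (p i * dot (H i) p)
      + dot p p * (q i * dot (H i) q) + n i * dot (H i) n.
    have := exp (e i) (H i); rewrite !dote.
    by rewrite (dotC (e i)) dote (dotC p (H i)) (dotC q (H i)) (dotC n (H i)).
  by rewrite mulr_sumr (eq_bigr _ (fun i _ => Hii i)) !big_split/= -!mulr_sumr.
have /eqP := conj; rewrite addr_eq0 => /eqP qHq.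
rewrite (dot_lappC p n Hsym) qHq in eP eQ eN eF eT *.
rewrite (dot_lappC q n Hsym) (dot_lappC p q Hsym) in eP eQ eN.
move: eP eQ eN eF eT.
set s := dot p p; set a := dot p (lapp H p).
set b := dot q (lapp H p); set c := dot n (lapp H p); set d := dot n (lapp H q).
set e := dot n (lapp H n); set P := dot (lapp H p) (lapp H p).
set Q := dot (lapp H q) (lapp H q); set N := dot (lapp H n) (lapp H n).
set F := \sum_(i < 3) dot _ _; set t := \sum_(i < 3) _ => eP eQ eN eF eT.
have -> : s ^+ 4 * (2 * P - s * F + s * t ^+ 2)
  = 2 * s ^+ 2 * (s ^+ 2 * P) - s * (s ^+ 2 * (s ^+ 2 * F)) + s * (s ^+ 2 * t) ^+ 2.
  by ring.
have -> : s ^+ 2 * (s ^+ 2 * F) = s * (s ^+ 2 * P) + s * (s ^+ 2 * Q) + s ^+ 2 * N.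
  by rewrite eF; ring.
by rewrite eP eQ eN eT; ring.
Qed.

(** The inequality is X < 0. A zero determinant forces [dot p p = 0] by [X_frame];
then X reduces to 2 |H p|^2, which is not negative. *)
Lemma frame_nondegenerate H p q : (forall i j, H i j = H j i) ->
  dot p q = 0 -> dot q q = dot p p ->
  dot q (lapp H q) + dot p (lapp H p) = 0 ->
  2 * dot (lapp H p) (lapp H p) - dot p p * \sum_(i < 3) dot (H i) (H i)
     + dot p p * (\sum_(i < 3) H i i) ^+ 2 < 0 ->
  dot (cross p q) (lapp H q) != 0.
Proof.
move=> Hsym pq qq qHq X0; apply/eqP => det0.
have := X_frame Hsym pq qq qHq; rewrite det0 expr0n/= mulr0 => /eqP.
rewrite mulf_eq0 (lt_eqF X0) orbF expf_eq0/= => /eqP pp0.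
move: X0; rewrite pp0 !mul0r subr0 addr0; apply/negP; rewrite -leNgt.
by rewrite mulr_ge0// sumr_ge0// => i _; rewrite -expr2 sqr_ge0.
Qed.

Definition cubic (T : 'I_3 -> 'I_3 -> 'I_3 -> R) u v w : R :=
  \sum_(i < 3) u i * dot v (lapp (T i) w).

(** The last three hypotheses are what the equations of a conjugate direction
become when they are differentiated, with [W] the derivative of [q], and [H],
[T] those of [p] and [H]. They give the images of [p], [q] and [lapp H q]
under [W], hence all the values of [skew W] on these vectors. *)
Lemma skew_conjugate H W (T : 'I_3 -> 'I_3 -> 'I_3 -> R) p q :
  (forall i j, H i j = H j i) ->
  (forall k, dot (H k) q + dot (W k) p = 0) ->
  (forall k, dot (W k) q = dot (H k) p) ->
  (forall k, dot q (lapp (T k) q) + 2 * dot (W k) (lapp H q)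
             + dot p (lapp (T k) p) + 2 * dot (H k) (lapp H p) = 0) ->
  [/\ skew W p q = dot p (lapp H p) + dot q (lapp H q),
      - 2 * skew W p (lapp H q) =
        cubic T p p p + cubic T p q q
        + 2 * dot (lapp H p) (lapp H p) - 2 * dot (lapp H q) (lapp H q)
    & - 2 * skew W q (lapp H q) =
        cubic T q p p + cubic T q q q + 4 * dot (lapp H p) (lapp H q)].
Proof.
move=> Hsym d1 d2 d3.
have Wp u : dot u (lapp W p) = - dot u (lapp H q).
  apply/eqP; rewrite -addr_eq0 /dot -big_split/= big1// => i _.
  by rewrite -mulrDr addrC -/(dot _ _) [X in _ * X]d1 mulr0.
have Wq u : dot u (lapp W q) = dot u (lapp H p).
  by apply: eq_bigr => i _; rewrite /lapp d2.
have W2 u : - 2 * dot u (lapp W (lapp H q)) = cubic T u q q + cubic T u p p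
    + 2 * dot u (lapp H (lapp H p)).
  apply/eqP; rewrite -subr_eq0 /cubic /dot !mulr_sumr -!big_split/= -sumrB/=.
  apply/eqP/big1 => i _.
  transitivity (- u i * (dot q (lapp (T i) q) + 2 * dot (W i) (lapp H q)
             + dot p (lapp (T i) p) + 2 * dot (H i) (lapp H p))).
    by rewrite /lapp /dot; ring.
  by rewrite d3 mulr0.
split; rewrite /skew.
- by rewrite Wq Wp opprK.
- by rewrite mulrBr W2 Wp (dot_lappC p (lapp H p) Hsym); ring.
- by rewrite mulrBr W2 Wq (dot_lappC q (lapp H p) Hsym) (dotC (lapp H q)); ring.
Qed.

Lemma dot_lappE H u v :
  \sum_(i < 3) \sum_(j < 3) H i j * u i * v j = dot u (lapp H v).
Proof.
apply: eq_bigr => i _; rewrite /lapp /dot mulr_sumr; apply: eq_bigr => j _.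
by rewrite mulrCA mulrA.
Qed.

Lemma lapp_lappE H u v : (forall i j, H i j = H j i) ->
  \sum_(i < 3) \sum_(j < 3) \sum_(k < 3) H i j * H j k * u i * v k
  = dot (lapp H u) (lapp H v).
Proof.
move=> Hsym; rewrite exchange_big; apply: eq_bigr => j _.
rewrite /lapp /dot mulr_suml; apply: eq_bigr => i _.
by rewrite mulr_sumr; apply: eq_bigr => k _; rewrite (Hsym i j); ring.
Qed.

Lemma lapp_sqE H u :
  \sum_(i < 3) \sum_(j < 3) \sum_(k < 3) H i j * u j * H i k * u k
  = dot (lapp H u) (lapp H u).
Proof.
apply: eq_bigr => i _; rewrite /lapp /dot mulr_suml; apply: eq_bigr => j _.
by rewrite mulr_sumr; apply: eq_bigr => k _; ring.
Qed.

Lemma cubicE (T : 'I_3 -> 'I_3 -> 'I_3 -> R) u v w :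
  \sum_(i < 3) \sum_(j < 3) \sum_(k < 3) T i j k * u i * v j * w k
  = cubic T u v w.
Proof.
apply: eq_bigr => i _; rewrite -dot_lappE mulr_sumr; apply: eq_bigr => j _.
by rewrite mulr_sumr; apply: eq_bigr => k _; ring.
Qed.

Lemma cubic_cyclic (T : 'I_3 -> 'I_3 -> 'I_3 -> R) u v w :
  (forall i j k, T i j k = T k i j) -> cubic T u v w = cubic T w u v.
Proof.
move=> Tcyc; rewrite -!cubicE.
rewrite [RHS]exchange_big/=; apply: eq_bigr => i _.
rewrite [RHS]exchange_big/=; apply: eq_bigr => j _.
by apply: eq_bigr => k _; rewrite Tcyc; ring.
Qed.

End VectorAlgebra.

(** * Equality of mixed derivatives *)

Section MixedDerivatives.
Local Set Implicit Arguments.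
Local Unset Strict Implicit.
Context {R : realType} {V : normedModType R}.
Implicit Types (g : V -> R) (x u v : V).

Lemma is_derive_line g x u (t : R) :
  derivable g (x + t *: u) u ->
  is_derive t (1 : R) (fun s : R => g (x + s *: u)) ('D_u g (x + t *: u)).
Proof.
have E : (fun h : R => h^-1 *: (((fun s : R => g (x + s *: u)) \o shift t) (h *: 1)
           - g (x + t *: u)))
       = (fun h : R => h^-1 *: ((g \o shift (x + t *: u)) (h *: u) - g (x + t *: u))).
  apply/funext => h /=; congr (_ *: (g _ - _)).
  by rewrite [h *: 1]mulr1 scalerDl addrCA addrA.
by move=> dg; apply: DeriveDef; rewrite /derivable /derive E.
Qed.

(** The mean value theorem is used once along [u], on the difference of [g]
between the two sides of the parallelogram parallel to [u], and then once along
[v]. The left-hand side is symmetric in [u] and [v], the right-hand side is not: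
this is what makes the two mixed derivatives comparable. *)
Lemma second_difference_MVT g x u v (h : R) : 0 < h ->
  (forall a b, 0 <= a <= h -> 0 <= b <= h ->
     derivable g (x + a *: u + b *: v) u
     /\ derivable ('D_u g) (x + a *: u + b *: v) v) ->
  exists a b, [/\ 0 <= a <= h, 0 <= b <= h &
    g (x + h *: u + h *: v) - g (x + h *: u) - g (x + h *: v) + g x
    = 'D_v ('D_u g) (x + a *: u + b *: v) * h ^+ 2].
Proof.
move=> h0 dg.
pose phi (t : R) := g (x + h *: v + t *: u) - g (x + t *: u).
pose dphi (t : R) := 'D_u g (x + h *: v + t *: u) - 'D_u g (x + t *: u).
have hh : 0 <= h <= h by rewrite ltW/=.
have phiE (t : R) : 0 <= t <= h -> is_derive t (1 : R) phi (dphi t).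
  move=> th.
  have [d1 _] := dg t h th hh; have [d0 _] := dg t 0 th (introT andP (conj (lexx _) (ltW h0))).
  rewrite scale0r addr0 in d0; rewrite addrAC in d1.
  exact: is_deriveB (is_derive_line d1) (is_derive_line d0).
have [||a ah phia] := @MVT_segment _ phi dphi 0 h (ltW h0).
- by move=> t; rewrite in_itv/= => /andP[t0 th]; apply: phiE; rewrite !ltW.
- apply: derivable_within_continuous => t; rewrite in_itv/= => th.
  by have := phiE t th.
rewrite in_itv/= in ah.
pose psi (s : R) := 'D_u g (x + a *: u + s *: v).
have psiE (s : R) : 0 <= s <= h ->
    is_derive s (1 : R) psi ('D_v ('D_u g) (x + a *: u + s *: v)).
  by move=> sh; have [_ d] := dg a s ah sh; exact: is_derive_line.
have [||b bh psib] := @MVT_segment _ psi (fun s => 'D_v ('D_u g) (x + a *: u + s *: v)) 0 h (ltW h0).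
- by move=> t; rewrite in_itv/= => /andP[t0 th]; apply: psiE; rewrite !ltW.
- apply: derivable_within_continuous => t; rewrite in_itv/= => th.
  by have := psiE t th.
rewrite in_itv/= in bh.
exists a, b; split=> //.
move: phia psib; rewrite /phi /dphi /psi !scale0r !addr0 !subr0.
rewrite (addrAC x (h *: v) (h *: u)) (addrAC x (h *: v) (a *: u)) => phia psib.
by rewrite expr2 mulrA -psib -phia opprD opprK !addrA.
Qed.

Lemma continuous_eq_at (F G : V -> R) x :
  {for x, continuous F} -> {for x, continuous G} ->
  (forall d : R, 0 < d ->
     exists y z, [/\ `|x - y| < d, `|x - z| < d & F y = G z]) ->
  F x = G x.
Proof.
move=> cF cG FG; apply/eqP; rewrite -subr_eq0 -normr_le0.
apply/ler_addgt0Pr => e e0; rewrite add0r.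
have e2 : 0 < e / 2 by rewrite divr_gt0.
move/cvgrPdist_le : cF => /(_ _ e2) nF; move/cvgrPdist_le : cG => /(_ _ e2) nG.
have [d /= d0 dFG] := (nbhs_normP _ _).1 (filterI nF nG).
have [y [z [xy xz Fy]]] := FG d d0.
have [Fxy _] := dFG _ xy; have [_ Gxz] := dFG _ xz.
rewrite /= distrC in Gxz.
apply: le_trans (ler_distD (F y) _ _) _.
by rewrite {2}Fy (splitr e) lerD.
Qed.

(** Schwarz's theorem. The second difference over a small parallelogram at [x] is
the same for the pairs [u], [v] and [v], [u]; so the two mixed derivatives agree
at two points arbitrarily close to [x], hence at [x] by continuity. *)
Lemma derive_comm g x u v :
  (\forall y \near x, derivable g y u /\ derivable ('D_u g) y v) ->
  (\forall y \near x, derivable g y v /\ derivable ('D_v g) y u) ->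
  {for x, continuous ('D_v ('D_u g))} -> {for x, continuous ('D_u ('D_v g))} ->
  'D_u ('D_v g) x = 'D_v ('D_u g) x.
Proof.
move=> nuv nvu cvu cuv; apply: (continuous_eq_at cuv cvu) => d d0.
have [d' /= d'0 dP] := (nbhs_normP _ _).1 (filterI nuv nvu).
pose m := Num.min d d'.
have m0 : 0 < m by rewrite lt_min d0.
(* This size keeps the parallelogram spanned by h *: u and h *: v in the ball
   of radius m; adding 1 covers u = v = 0. *)
pose h := m / (`|u| + `|v| + 1).
have k0 : 0 < `|u| + `|v| + 1 by rewrite ltr_wpDl// addr_ge0.
have h0 : 0 < h by rewrite divr_gt0.
have near_x (a b : R) : 0 <= a <= h -> 0 <= b <= h ->
    `|x - (x + a *: u + b *: v)| < m.
  move=> /andP[a0 ah] /andP[b0 bh].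
  rewrite -addrA opprD addrA subrr add0r normrN.
  rewrite (le_lt_trans (ler_normD _ _))// !normrZ (ger0_norm a0) (ger0_norm b0).
  have -> : m = h * (`|u| + `|v| + 1) by rewrite divfK// gt_eqF.
  rewrite !mulrDr mulr1 (le_lt_trans _ (ltr_pwDr h0 (lexx _)))//.
  by rewrite lerD// ler_wpM2r.
have md : m <= d by rewrite ge_min lexx.
have md' : m <= d' by rewrite ge_min lexx orbT.
have dD (a b : R) (ah : 0 <= a <= h) (bh : 0 <= b <= h) :=
  dP _ (lt_le_trans (near_x a b ah bh) md').
have E1 := @second_difference_MVT g x u v h h0.
have {E1}[|a [b [ah bh E1]]] := E1.
  by move=> a b ah bh; have [duv _] := dD a b ah bh; exact: duv.
have E2 := @second_difference_MVT g x v u h h0.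
have {E2}[|b' [a' [bh' ah' E2]]] := E2.
  move=> b' a' bh' ah'; have [_ dvu] := dD a' b' ah' bh'.
  by rewrite addrAC; exact: dvu.
rewrite (addrAC x (h *: v)) (addrAC x (b' *: v)) in E2.
exists (x + a' *: u + b' *: v), (x + a *: u + b *: v); split.
- exact: lt_le_trans (near_x _ _ ah' bh') md.
- exact: lt_le_trans (near_x _ _ ah bh) md.
have h2 : h ^+ 2 != 0 by rewrite expf_neq0// gt_eqF.
move: E1 E2; rewrite (addrAC (g (x + h *: u + h *: v))) => -> E.
exact/esym/(mulIf h2)/E.
Qed.

End MixedDerivatives.

(** * Differentiation of forms on an open set *)

Section FlatForms.
Context {R : realType}.
Local Set Implicit Arguments.
Local Unset Strict Implicit.
Context (U : set 'rV[R]_3) (U_open : open U).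
Implicit Types (g : 'rV[R]_3 -> R) (u v : 'I_3 -> 'rV[R]_3 -> R).

Lemma open_near (P : 'rV[R]_3 -> Prop) x :
  (forall y, U y -> P y) -> U x -> \forall y \near x, P y.
Proof. by move=> UP Ux; apply: filterS (open_nbhs_nbhs (conj U_open Ux)). Qed.

Lemma smooth_continuous g x : smooth U g -> U x -> {for x, continuous g}.
Proof. by move=> sg Ux; exact: (sg 0%N). Qed.

Lemma smooth_derivable g x i : smooth U g -> U x -> derivable g x (delta_mx 0 i).
Proof. by move=> sg Ux; have [_ /(_ i)[/(_ x Ux)]] := sg 1%N. Qed.

Lemma smooth_nabla g i : smooth U g -> smooth U (nabla i g).
Proof. by move=> sg k; have [_ /(_ i)[]] := sg k.+1. Qed.

Lemma nabla_comm g x i j : smooth U g -> U x ->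
  nabla i (nabla j g) x = nabla j (nabla i g) x.
Proof.
move=> sg Ux; apply: derive_comm.
- apply: open_near Ux => y Uy; split; first exact: smooth_derivable.
  exact/smooth_derivable/Uy/smooth_nabla.
- apply: open_near Ux => y Uy; split; first exact: smooth_derivable.
  exact/smooth_derivable/Uy/smooth_nabla.
- by apply: smooth_continuous Ux; do 2!apply: smooth_nabla.
- by apply: smooth_continuous Ux; do 2!apply: smooth_nabla.
Qed.

Lemma nabla_eq g h x i : (forall y, U y -> g y = h y) -> U x ->
  nabla i g x = nabla i h x.
Proof.
by move=> gh Ux; apply: near_eq_derive; exact: open_near Ux.
Qed.

(** The inner pair of derivatives commutes at every point of [U], so it may be
exchanged before differentiating again; the outer pair is then exchanged for
the function [nabla j g]. *)
Lemma nabla3_cyclic g x i j k : smooth U g -> U x ->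
  nabla3 i j k g x = nabla3 k i j g x.
Proof.
move=> sg Ux; rewrite /nabla3.
rewrite (nabla_eq i (fun y => @nabla_comm g y j k sg) Ux).
exact/nabla_comm/Ux/smooth_nabla.
Qed.

Lemma nabla_dot u v x i :
  (forall j, derivable (u j) x (delta_mx 0 i)) ->
  (forall j, derivable (v j) x (delta_mx 0 i)) ->
  is_derive x (delta_mx 0 i) (fun y => dot (u ^~ y) (v ^~ y))
    (dot (u ^~ x) (fun j => nabla i (v j) x) + dot (v ^~ x) (fun j => nabla i (u j) x)).
Proof.
move=> du dv.
have -> : (fun y => dot (u ^~ y) (v ^~ y)) = \sum_(j < 3) (u j * v j).
  by apply/funext => y; rewrite fct_sumE.
rewrite /dot -big_split/=; apply: is_derive_sum => j.
by apply: is_deriveM; apply: derivableP.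
Qed.

Lemma nabla_quadratic (A : 'I_3 -> 'I_3 -> 'rV[R]_3 -> R) u x k :
  (forall i j, A i j x = A j i x) ->
  (forall i j, derivable (A i j) x (delta_mx 0 k)) ->
  (forall i, derivable (u i) x (delta_mx 0 k)) ->
  is_derive x (delta_mx 0 k)
    (fun y => dot (u ^~ y) (lapp (fun i j => A i j y) (u ^~ y)))
    (dot (u ^~ x) (lapp (fun i j => nabla k (A i j) x) (u ^~ x))
     + 2 * dot (fun i => nabla k (u i) x) (lapp (fun i j => A i j x) (u ^~ x))).
Proof.
move=> Asym dA du.
pose v i y := dot (A i ^~ y) (u ^~ y).
have dv i := nabla_dot (dA i) du.
have dvE i : nabla k (v i) x = dot (fun j => A i j x) (fun j => nabla k (u j) x)
    + dot (u ^~ x) (fun j => nabla k (A i j) x) by have [_] := dv i.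
have [d dE] := @nabla_dot u v x k du (fun i => let: DeriveDef d _ := dv i in d).
apply: DeriveDef => //; rewrite dE.
have -> : dot (u ^~ x) (fun i => nabla k (v i) x) =
    dot (u ^~ x) (lapp (fun i j => A i j x) (fun j => nabla k (u j) x))
    + dot (u ^~ x) (lapp (fun i j => nabla k (A i j) x) (u ^~ x)).
  rewrite /dot -big_split/=; apply: eq_bigr => i _.
  by rewrite dvE -mulrDr (dotC (u ^~ x)).
rewrite (dot_lappC _ _ Asym) (dotC (v ^~ x)) mulr_natl mulr2n.
by rewrite addrAC addrC.
Qed.

End FlatForms.

(** * Symmetry of the derivative of a conjugate direction *)

Theorem theorem3 (R : realType) (U : set 'rV[R]_3) (f : 'rV[R]_3 -> R)
    (w : 'I_3 -> 'rV[R]_3 -> R)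
    (U_open : open U)
    (f_smooth : smooth U f)
    (X_neg : forall x, U x -> Xquant f x < 0)
    (w_smooth : smooth_form U w)
    (w_conj : conjugate_direction U f w) :
  (forall x, U x -> forall i j : 'I_3, nabla i (w j) x = nabla j (w i) x)
  <->
  ((forall x, U x ->
      \sum_(i < 3) \sum_(j < 3) \sum_(k < 3)
        nabla3 i j k f x * nabla i f x * nabla j f x * nabla k f x
      + \sum_(i < 3) \sum_(j < 3) \sum_(k < 3)
        nabla3 i j k f x * nabla i f x * w j x * w k x
      + 2 * (\sum_(i < 3) \sum_(j < 3) \sum_(k < 3)
        nabla2 i j f x * nabla2 j k f x * nabla i f x * nabla k f x)
      - 2 * (\sum_(i < 3) \sum_(j < 3) \sum_(k < 3)
        nabla2 i j f x * nabla2 j k f x * w i x * w k x) = 0)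
   /\
   (forall x, U x ->
      \sum_(i < 3) \sum_(j < 3) \sum_(k < 3)
        nabla3 i j k f x * nabla i f x * nabla j f x * w k x
      + \sum_(i < 3) \sum_(j < 3) \sum_(k < 3)
        nabla3 i j k f x * w i x * w j x * w k x
      + 4 * (\sum_(i < 3) \sum_(j < 3) \sum_(k < 3)
        nabla2 i j f x * nabla2 j k f x * nabla i f x * w k x) = 0)).
Proof.
have dcomm x i j : U x -> nabla2 i j f x = nabla2 j i f x.
  by move=> Ux; exact: (nabla_comm U_open).
have df x i j : U x -> derivable (nabla j f) x (delta_mx 0 i).
  by move=> Ux; apply: smooth_derivable Ux; apply: smooth_nabla.
have d2f x i j k : U x -> derivable (nabla2 j k f) x (delta_mx 0 i).
  by move=> Ux; apply: smooth_derivable Ux; do 2!apply: smooth_nabla.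
have dw x i j : U x -> derivable (w j) x (delta_mx 0 i).
  by move=> Ux; apply: smooth_derivable Ux; exact: w_smooth.
pose p x i := nabla i f x; pose q x i := w i x.
pose H x i j := nabla2 i j f x; pose T x i j k := nabla3 i j k f x.
pose W x i j := nabla i (w j) x.
have pq x : U x -> dot (p x) (q x) = 0 by move=> /w_conj[].
have qq x : U x -> dot (q x) (q x) = dot (p x) (p x) by move=> /w_conj[].
have qHq x : U x -> dot (q x) (lapp (H x) (q x)) + dot (p x) (lapp (H x) (p x)) = 0.
  by move=> /w_conj[_ _ <-]; rewrite !dot_lappE.
(* The derivatives in direction k of the three equations of a conjugate
   direction, which hold near x because U is open. *)
have d1 x k : U x -> dot (H x k) (q x) + dot (W x k) (p x) = 0.
  move=> Ux; have := nabla_eq U_open k pq Ux; rewrite {2}/nabla derive_cst => <-.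
  have D := @nabla_dot R (fun i => nabla i f) w x k (fun j => df x k j Ux) (fun j => dw x k j Ux).
  by rewrite [RHS]derive_val addrC (dotC (W x k)) (dotC (H x k)).
have d2 x k : U x -> dot (W x k) (q x) = dot (H x k) (p x).
  move=> Ux; have := nabla_eq U_open k qq Ux.
  have D := @nabla_dot R w w x k (fun j => dw x k j Ux) (fun j => dw x k j Ux).
  have D' := @nabla_dot R _ _ x k (fun j => df x k j Ux) (fun j => df x k j Ux).
  rewrite [LHS]derive_val [RHS]derive_val (dotC (W x k)) (dotC (H x k)).
  by rewrite -!mulr2n => /eqP; rewrite eqr_pMn2r// => /eqP.
have d3 x k : U x ->
    dot (q x) (lapp (T x k) (q x)) + 2 * dot (W x k) (lapp (H x) (q x))
    + dot (p x) (lapp (T x k) (p x)) + 2 * dot (H x k) (lapp (H x) (p x)) = 0.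
  move=> Ux; have := nabla_eq U_open k qHq Ux; rewrite {2}/nabla derive_cst => <-.
  have D := @nabla_quadratic R (fun i j => nabla2 i j f) w x k
    (fun i j => dcomm x i j Ux) (fun i j => d2f x k i j Ux) (fun j => dw x k j Ux).
  have D' := @nabla_quadratic R (fun i j => nabla2 i j f) (fun i => nabla i f) x k
    (fun i j => dcomm x i j Ux) (fun i j => d2f x k i j Ux) (fun j => df x k j Ux).
  by rewrite [RHS](@derive_val _ _ _ _ _ _ _ (is_deriveD D D')) !addrA.
have Hsym x : U x -> forall i j, H x i j = H x j i.
  by move=> Ux i j; exact: dcomm.
have Tcyc x : U x -> forall i j k, T x i j k = T x k i j.
  by move=> Ux i j k; exact: (nabla3_cyclic U_open).
have XE x : Xquant f x = 2 * dot (lapp (H x) (p x)) (lapp (H x) (p x))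
    - dot (p x) (p x) * \sum_(i < 3) dot (H x i) (H x i)
    + dot (p x) (p x) * (\sum_(i < 3) H x i i) ^+ 2.
  by rewrite -lapp_sqE.
have skews x (Ux : U x) := skew_conjugate (Hsym x Ux) (fun k => d1 x k Ux)
  (fun k => d2 x k Ux) (fun k => d3 x k Ux).
(* X < 0 makes p, q and H q independent; the remaining pair p, q satisfies
   skew = 0 by the third equation of a conjugate direction. *)
have symP x : U x -> (forall i j, W x i j = W x j i) <->
    skew (W x) (p x) (lapp (H x) (q x)) = 0 /\ skew (W x) (q x) (lapp (H x) (q x)) = 0.
  move=> Ux; split=> [Wsym|[s1 s2] i j].
    by split; rewrite /skew (dot_lappC _ _ Wsym) subrr.
  have X0 := X_neg x Ux; rewrite XE in X0.
  have ndeg := frame_nondegenerate (Hsym x Ux) (pq x Ux) (qq x Ux) (qHq x Ux) X0.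
  have [s0 _ _] := skews x Ux; rewrite addrC qHq// in s0.
  by apply/eqP; rewrite -subr_eq0 -(mulrI_eq0 _ (mulfI ndeg)) (skew_cramer i j s0 s1 s2).
have eq1 x (Ux : U x) :
    \sum_(i < 3) \sum_(j < 3) \sum_(k < 3)
        nabla3 i j k f x * nabla i f x * nabla j f x * nabla k f x
      + \sum_(i < 3) \sum_(j < 3) \sum_(k < 3)
        nabla3 i j k f x * nabla i f x * w j x * w k x
      + 2 * (\sum_(i < 3) \sum_(j < 3) \sum_(k < 3)
        nabla2 i j f x * nabla2 j k f x * nabla i f x * nabla k f x)
      - 2 * (\sum_(i < 3) \sum_(j < 3) \sum_(k < 3)
        nabla2 i j f x * nabla2 j k f x * w i x * w k x)
    = - 2 * skew (W x) (p x) (lapp (H x) (q x)).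
  have [_ -> _] := skews x Ux.
  by rewrite -!(lapp_lappE _ _ (Hsym x Ux)) -!cubicE.
have eq2 x (Ux : U x) :
    \sum_(i < 3) \sum_(j < 3) \sum_(k < 3)
        nabla3 i j k f x * nabla i f x * nabla j f x * w k x
      + \sum_(i < 3) \sum_(j < 3) \sum_(k < 3)
        nabla3 i j k f x * w i x * w j x * w k x
      + 4 * (\sum_(i < 3) \sum_(j < 3) \sum_(k < 3)
        nabla2 i j f x * nabla2 j k f x * nabla i f x * w k x)
    = - 2 * skew (W x) (q x) (lapp (H x) (q x)).
  have [_ _ ->] := skews x Ux.
  (* In cubic T q p p the vector q is contracted with the outermost derivative,
     in the sum over i, j, k it is contracted with the innermost one. *)
  rewrite -(cubic_cyclic (p x) (p x) (q x) (Tcyc x Ux)).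
  by rewrite -!(lapp_lappE _ _ (Hsym x Ux)) -!cubicE.
have m2 (a : R) : - 2 * a = 0 <-> a = 0.
  split=> [/eqP|->]; last by rewrite mulr0.
  by rewrite mulf_eq0 oppr_eq0 pnatr_eq0/= => /eqP.
split=> [Wsym|[c1 c2] x Ux].
  split=> x Ux; have [s1 s2] := (symP x Ux).1 (Wsym x Ux).
    by rewrite eq1// s1 mulr0.
  by rewrite eq2// s2 mulr0.
apply/(symP x Ux); split; apply/m2.
  by rewrite -eq1// c1.
by rewrite -eq2// c2.
Qed.
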